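(* For every numerical semigroup $\mathcal{S}$ of genus $g\geq 1$, \[ 3g-2-\operatorname{ewt}(\mathcal{S})\;\leq\;2g-2+\lambda(\mathcal{S})-\dim_{\mathbf{k}}\mathrm{T}^{1,+}(\mathbf{k}[\mathcal{S}]). \]
   Context: $\mathbf{k}$ is an algebraically closed field of characteristic zero. A numerical semigroup $\mathcal{S}\subset\mathbb{N}=\{0,1,2,\dots\}$ is a submonoid with finite complement; its elements are called nongaps, the elements of $\mathbb{N}\setminus\mathcal{S}$ are called gaps, and the number of gaps is the genus $g$ of $\mathcal{S}$. Let $n_1<\dots<n_r$ be the minimal system of generators of $\mathcal{S}$. The effective weight of $\mathcal{S}$ is $\operatorname{ewt}(\mathcal{S})=\sum_{\ell\in\mathbb{N}\setminus\mathcal{S}}\#\{j\mid n_j<\ell\}$ (sum over the gaps of the number of minimal generators smaller than the gap). $\lambda(\mathcal{S})=\#(\operatorname{End}(\mathcal{S})\setminus\mathcal{S})$, where $\operatorname{End}(\mathcal{S})=\{n\in\mathbb{N}\mid n+(\mathcal{S}\setminus\{0\})\subset\mathcal{S}\}$. $\mathbf{k}[\mathcal{S}]=\bigoplus_{n\in\mathcal{S}}\mathbf{k}\,t^n$ is the semigroup algebra. Write $\mathbf{k}[\mathcal{S}]=\mathcal{P}/I$ with $\mathcal{P}=\mathbf{k}[X_1,\dots,X_r]$, $\deg X_i=n_i$, $X_i\mapsto t^{n_i}$. Then $\mathrm{T}^1(\mathbf{k}[\mathcal{S}])$ is the first cohomology module of the cotangent complex of $\mathbf{k}[\mathcal{S}]$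 over $\mathbf{k}$, i.e. the cokernel of the natural map $\operatorname{Der}_{\mathbf{k}}(\mathcal{P},\mathbf{k}[\mathcal{S}])\to\operatorname{Hom}_{\mathcal{P}}(I,\mathbf{k}[\mathcal{S}])$, with its natural $\mathbb{Z}$-grading (a homomorphism has degree $\ell$ if it sends elements of degree $d$ to elements of degree $d+\ell$). $\mathrm{T}^{1,+}(\mathbf{k}[\mathcal{S}])=\bigoplus_{\ell>0}\mathrm{T}^1(\mathbf{k}[\mathcal{S}])_\ell$ is its positive graded part. *)

(* Defs.v *)
From HB Require Import structures.
From mathcomp Require Import all_boot all_order all_algebra.
From mathcomp Require Import finmap.
From mathcomp Require Import boolp classical_sets functions cardinality.
From mathcomp Require Import mpoly zify.

Set Implicit Arguments.
Unset Strict Implicit.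
Unset Printing Implicit Defensive.

Import GRing.Theory.

Local Open Scope classical_set_scope.
Local Open Scope ring_scope.

Record numsemigroup := NumSemigroup {
  nongap :> set nat;
  nongap0 : nongap 0%N;
  nongapD : forall m n, nongap m -> nongap n -> nongap (m + n)%N;
  finite_gaps : finite_set (~` nongap)
}.

Definition genus (S : numsemigroup) : nat := #|` fset_set (~` S)|.

Definition End (S : numsemigroup) : set nat :=
  [set n | forall s, nongap S s -> s <> 0%N -> nongap S (n + s)%N].

(* fset_set sends infinite sets to fset0, but End S `\` S is finite, being
   contained in the set of gaps. *)
Definition lambda (S : numsemigroup) : nat := #|` fset_set (End S `\` S)|.

(* The submonoid of nat generated by the n i such that A i. *)
Definition nat_span (r : nat) (n : 'I_r -> nat) (A : pred 'I_r) : set nat :=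
  [set m | exists c : 'I_r -> nat, m = (\sum_(i | A i) c i * n i)%N].

(* The minimal system of generators n_1 < ... < n_r of S, indexed by 'I_r:
   no proper subfamily generates S. *)
Record mingens (S : numsemigroup) := MinGens {
  embdim : nat;
  gen :> 'I_embdim -> nat;
  gen_mono : forall i j : 'I_embdim, (i < j)%N -> (gen i < gen j)%N;
  gen_span : nat_span gen predT = S;
  gen_min : forall A : pred 'I_embdim, nat_span gen A = S -> forall i, A i
}.

Lemma nongap_gen (S : numsemigroup) (n : mingens S) i : nongap S (n i).
Proof.
rewrite -(gen_span n); exists (fun j => nat_of_bool (j == i)).
rewrite (bigD1 i) //= eqxx mul1n big1 ?addn0 // => j /negPf ->.
by rewrite mul0n.
Qed.

Lemma nongap_lc (S : numsemigroup) (r : nat) (n c : 'I_r -> nat) (A : pred 'I_r) :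
  (forall i, nongap S (n i)) -> nongap S (\sum_(i | A i) c i * n i)%N.
Proof.
move=> Sn; elim/big_ind: _ => [|x y|i _]; first exact: nongap0.
  exact: nongapD.
elim: (c i) => [|m IH]; first by rewrite mul0n; exact: nongap0.
by rewrite mulSn; exact: nongapD.
Qed.

Lemma mingens_exists (S : numsemigroup) : inhabited (mingens S).
Proof.
have [c c0 Sc] : exists2 c, (0 < c)%N & forall m, (c <= m)%N -> nongap S m.
  have := finite_gaps S => /finite_fsetP[X XE].
  exists (\sum_(x <- X) x).+1 => // m cm; apply: contrapT => nSm.
  have mX : m \in X by have : (~` S) m by []; rewrite XE.
  by move: cm; rewrite (big_fsetD1 m) //= ltnNge leq_addr.
pose atom a := [/\ nongap S a, a <> 0%N &
  forall x y, nongap S x -> nongap S y -> a = (x + y)%N -> x = 0%N \/ y = 0%N].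
pose s := [seq a <- iota 0 (c + c) | `[< atom a >]].
have atomP a : reflect (atom a) (a \in s).
  rewrite mem_filter mem_iota /= add0n.
  apply: (iffP andP) => [[/asboolP//]|ata]; split; first exact/asboolP.
  rewrite ltnNge; apply/negP => ca; case: ata => _ _ /(_ c (a - c)%N).
  case; [exact: Sc|apply: Sc; lia|lia|lia|lia].
pose n (i : 'I_(size s)) := nth 0%N s i.
have atn i : atom (n i) by apply/atomP; rewrite mem_nth.
have ss : sorted ltn s by apply: sorted_filter (iota_ltn_sorted _ _); exact: ltn_trans.
have nm (i j : 'I_(size s)) : (i < j)%N -> (n i < n j)%N.
  by move=> ij; apply: (sorted_ltn_nth ltn_trans) => //; rewrite inE.
have ninj i j : n i = n j -> i = j.
  by move=> e; apply: val_inj; case: (ltngtP i j) => // /nm; rewrite e ltnn.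
have Sn i : nongap S (n i) by case: (atn i).
constructor; exists (size s) n => //.
  apply/seteqP; split=> [m [d ->]|m]; first exact: nongap_lc.
  elim/ltn_ind: m => m IH Sm.
  have [->|/eqP m0] := eqVneq m 0%N.
    by exists (fun=> 0%N); rewrite big1.
  have [ma|nma] := pselect (atom m).
    have ms : m \in s by apply/atomP.
    have im : (index m s < size s)%N by rewrite index_mem.
    exists (fun j => nat_of_bool (j == Ordinal im)).
    rewrite (bigD1 (Ordinal im)) //= eqxx mul1n big1 ?addn0 => [|j /negPf->//].
    by rewrite /n nth_index.
  have [x [y [Sx Sy mE x0 y0]]] : exists x y,
      [/\ nongap S x, nongap S y, m = (x + y)%N, x <> 0%N & y <> 0%N].
    apply: contrapT => H; apply: nma; split=> // x y Sx Sy mE.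
    have [|x0] := pselect (x = 0%N); first by left.
    have [|y0] := pselect (y = 0%N); first by right.
    by case: H; exists x, y.
  have [|//|d1 dE] := IH x; first lia.
  have [|//|d2 eE] := IH y; first lia.
  exists (fun i => d1 i + d2 i)%N; rewrite mE dE eE -big_split /=.
  by apply: eq_bigr => i _; rewrite mulnDl.
move=> A AS i; have : nat_span n A (n i) by rewrite AS; exact: Sn.
move=> [d dE]; case: (atn i) => _ n0 nadd.
have [j Aj dj] : exists2 j, A j & (0 < d j)%N.
  apply: contrapT => H; apply: n0; rewrite dE big1 // => j Aj.
  by case: (posnP (d j)) => [->//|dj]; case: H; exists j.
suff -> : i = j by [].
apply: ninj; pose d' (l : 'I_(size s)) := if l == j then (d j).-1 else d l.
have E : n i = (n j + \sum_(l | A l) d' l * n l)%N.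
  rewrite dE (bigD1 j) //= [in RHS](bigD1 j) //= addnA /d' eqxx -mulSn prednK //.
  by congr addn; apply: eq_bigr => l /andP[_ /negPf->].
case: (nadd _ _ (Sn j) (nongap_lc d' A Sn) E) => [nj0|r0].
  by case: (atn j) => _ [].
by rewrite E r0 addn0.
Qed.

Definition ewt (S : numsemigroup) (n : mingens S) : nat :=
  (\sum_(l <- fset_set (~` S)) #|[pred j | n j < l]|)%N.

Section SemigroupAlgebra.
Variables (k : fieldType) (S : numsemigroup).

Definition supported_in : {pred {poly k}} :=
  fun p => `[< forall m, p`_m != 0 -> nongap S m >].

Lemma supported_in_subalg : GRing.subsemialg_closed supported_in.
Proof.
split.
- apply/asboolP => m; rewrite coef1.
  by case: m => [|m]; rewrite ?eqxx // => _; exact: nongap0.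
- split; first by apply/asboolP => m; rewrite coef0 eqxx.
  move=> p q /asboolP Sp /asboolP Sq; apply/asboolP => m; rewrite coefD.
  have [->|p0] := eqVneq p`_m 0; last by move=> _; exact: Sp.
  by rewrite add0r; exact: Sq.
- move=> a p /asboolP Sp; apply/asboolP => m; rewrite coefZ.
  have [->|p0] := eqVneq p`_m 0; last by move=> _; exact: Sp.
  by rewrite mulr0 eqxx.
- move=> p q /asboolP Sp /asboolP Sq; apply/asboolP => m; rewrite coefM.
  apply: contra_neqP => nS; rewrite big1 // => i _.
  have [-> |p0] := eqVneq p`_i 0; first by rewrite mul0r.
  have [-> |q0] := eqVneq q`_(m - i) 0; first by rewrite mulr0.
  case: nS; have im : (i <= m)%N by rewrite -ltnS.
  by have := nongapD (Sp _ p0) (Sq _ q0); rewrite subnKC.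
Qed.

(* k[S], as the subalgebra of k[t] spanned by the t^s with s in S. *)
Record sgalg := SgAlg { sgpoly :> {poly k}; _ : sgpoly \in supported_in }.

HB.instance Definition _ := [isSub for sgpoly].
HB.instance Definition _ := [Choice of sgalg by <:].
HB.instance Definition _ :=
  GRing.SubChoice_isSubAlgebra.Build k {poly k} supported_in sgalg
    supported_in_subalg.
HB.instance Definition _ := [SubNzRing_isSubComNzRing of sgalg by <:].

Lemma supported_inXn s : nongap S s -> 'X^s \in supported_in.
Proof.
move=> Ss; apply/asboolP => m; rewrite coefXn.
by have [->|] := eqVneq m s; rewrite ?eqxx.
Qed.

Definition sgmon s (Ss : nongap S s) : sgalg := SgAlg (supported_inXn Ss).

(* The degree-e part of k[S]; it is {0} unless e is an element of S. *)
Definition sg_homog (e : int) : set sgalg :=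
  [set f | forall m : nat, f`_m != 0 -> m%:Z = e].

End SemigroupAlgebra.

(* For subspaces A and B of V, the image of A in V / B has dimension d: the
   classes of the e i form a basis of it. *)
Definition dim_mod (k : fieldType) (V : lmodType k) (A B : set V) (d : nat) :=
  exists e : 'I_d -> V, (forall i, A (e i)) /\
    forall v, A v -> exists! c : 'rV[k]_d, B (v - \sum_i c 0 i *: e i).

Section WeightedDegree.
Variables (r : nat) (w : 'I_r -> nat).

Definition wdeg (m : 'X_{1..r}) : nat := (\sum_i m i * w i)%N.

Lemma wdeg0 : wdeg 0%MM = 0%N.
Proof. by rewrite /wdeg big1 // => i _; rewrite mnm0E. Qed.

Lemma wdegD : {morph wdeg : m1 m2 / (m1 + m2)%MM >-> (m1 + m2)%N}.
Proof.
move=> m1 m2; rewrite /wdeg -big_split /=.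
by apply: eq_bigr => i _; rewrite mnmDE mulnDl.
Qed.

HB.instance Definition _ := isMeasure.Build r wdeg wdeg0 wdegD.

End WeightedDegree.

Section T1.
Variables (k : fieldType) (S : numsemigroup) (n : mingens S).

Local Notation r := (embdim n).
Local Notation P := {mpoly k[r]}.
Local Notation kS := (sgalg k S).

Definition pres : P -> kS :=
  mmap (in_alg kS) (fun i : 'I_r => sgmon k (nongap_gen i)).
HB.instance Definition _ := GRing.RMorphism.on pres.

Definition pres_ker : {pred P^o} := fun p => pres p == 0.

Lemma pres_ker_submod : GRing.subsemimod_closed pres_ker.
Proof.
split=> [|a p /eqP p0]; last first.
  rewrite unfold_in; apply/eqP; transitivity (pres a * pres p).
    exact: rmorphM.
  by rewrite p0 mulr0.
split=> [|p q /eqP p0 /eqP q0]; rewrite unfold_in; apply/eqP.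
  exact: rmorph0.
transitivity (pres p + pres q); first exact: rmorphD.
by rewrite p0 q0 addr0.
Qed.

(* I = ker (P -> k[S]), as a P-submodule of P. *)
Record relideal := RelIdeal { relpoly : P^o; _ : relpoly \in pres_ker }.

HB.instance Definition _ := [isSub for relpoly].
HB.instance Definition _ := [Choice of relideal by <:].
HB.instance Definition _ :=
  GRing.SubChoice_isSubLmodule.Build P P^o pres_ker relideal pres_ker_submod.

(* Hom_P(I, k[S]), where P acts on k[S] through pres. *)
Definition homI : set (relideal -> kS) :=
  [set f | linear_for (pres \; *%R) f].

Definition homI_deg (l : int) : set (relideal -> kS) :=
  [set f | homI f /\ forall (d : nat) (x : relideal),
     (relpoly x : P) \is ishomog1 d (wdeg n) -> sg_homog (d%:Z + l) (f x)].

(* The sum of the graded parts of Hom_P(I, k[S]) of degree l > 0. *)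
Definition homI_pos : set (relideal -> kS) :=
  [set f | exists (N : nat) (h : 'I_N -> relideal -> kS),
     (forall i : 'I_N, homI_deg i.+1%:Z (h i)) /\ f = \sum_i h i].

(* Der_k(P, k[S]), with the same action of P on k[S]. *)
Definition derP : set (P -> kS) :=
  [set D | linear D /\ forall p q, D (p * q) = pres p * D q + pres q * D p].

Definition derP_image : set (relideal -> kS) :=
  [set f | exists2 D, derP D & f = (fun x : relideal => D (relpoly x))].

(* T^1 is homI modulo derP_image. As derP_image is a graded submodule, the
   positive part of T^1 is the image of homI_pos in this quotient. *)
Definition T1_pos_dim (d : nat) : Prop := dim_mod homI_pos derP_image d.

End T1.

(* Main.v *)
Require Import Defs.
From mathcomp Require Import all_boot all_order all_algebra.
From mathcomp Require Import finmap boolp classical_sets functions cardinality.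
From mathcomp Require Import mpoly zify.

Set Implicit Arguments.
Unset Strict Implicit.
Unset Printing Implicit Defensive.

Import GRing.Theory.

Local Open Scope ring_scope.

(** Let f : I -> k[S] be a homomorphism of degree l > 0.  Over k[t], which
    contains k[S], f is the restriction to I of a derivation
    X_i |-> c_i t^(n_i + l) ([hom_is_derivation]): f is determined by its values on the binomials
    X^a - X^b of equal weight, those values are additive in (a, b), and so
    they come from a linear form c, computed by comparing every variable with
    one chosen variable X_j.  Dividing by n_j is where characteristic zero
    enters.  Since the Euler derivation c_i = n_i vanishes on I, one coordinate
    of c is redundant; comparing with X_j produces the c for which c_j = 0.

    Whenever n_i + l lies in S, the i-th term of this derivation takes values in
    k[S], and it dies in T^1.  So the class of f in T^1 is determined
    by the c_i with n_i + l not in S and i <> j.  If l is in End(S) there are no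
    such i; otherwise the chosen j may itself be taken with n_j + l not in S.
    Collecting all degrees ([dim_mod_le], [T1_pos_dim_le]), the dimension of
    the positive part of T^1 is at most the number of pairs (l, i) with n_i + l
    a gap, minus the number of l outside End(S).

    The map (l, i) |-> (n_i + l, i) embeds these pairs into the pairs (m, i)
    with m a gap and n_i < m, whose number is ewt(S), while g exceeds
    lambda(S) by the number of l outside End(S) ([card_T1_index]).  Together:
    dim T^(1,+) + g <= ewt(S) + lambda(S), which is the claim. *)

(** * Dimension of a quotient *)

(** Coordinates on A modulo B need not be functions on A: it is enough to have
    a linear relation R between vectors and rows of length N that is total on A
    and relates only elements of B to the zero row.  The relational form spares
    checking which rows occur.  A family of A that is independent modulo B has
    independent rows, so N bounds its length, and a longest such family is a
    basis of A modulo B. *)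
Lemma dim_mod_le (k : fieldType) (V : lmodType k) (A B : set V) (N : nat)
    (R : V -> 'rV[k]_N -> Prop) :
    B 0 -> (forall a u v, B u -> B v -> B (a *: u + v)) ->
    R 0 0 ->
    (forall a u v b c, R u b -> R v c -> R (a *: u + v) (a *: b + c)) ->
    (forall v, A v -> exists c, R v c) -> (forall v, R v 0 -> B v) ->
  exists2 d, dim_mod A B d & (d <= N)%N.
Proof.
move=> B0 Blin R0 Rlin Rtot RB.
pose free_mod d (e : 'I_d -> V) := (forall i, A (e i)) /\
  forall c : 'rV[k]_d, B (\sum_i c 0 i *: e i) -> c = 0.
have free_le d (e : 'I_d -> V) : free_mod d e -> (d <= N)%N.
  move=> [Ae efree].
  have [C RC] := choice (fun i => Rtot _ (Ae i)).
  pose M := \matrix_i C i.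
  suff /eqP <- : row_free M by exact: rank_leq_col.
  apply: inj_row_free => u uM; apply: efree; apply: RB.
  rewrite -uM mulmx_sum_row.
  elim/big_rec2: _ => [|i c v _ Rvc]; first exact: R0.
  by rewrite rowK; exact: Rlin.
pose free_dim d := `[< exists e, free_mod d e >].
have free0 : exists d, free_dim d.
  exists 0%N; apply/asboolP; exists (fun _ => 0); split=> [[]//|c _].
  by apply/rowP => -[].
have free_bound d : free_dim d -> (d <= N)%N.
  by move=> /asboolP[e]; exact: free_le.
have [d /asboolP[e [Ae efree]] dmax] := ex_maxnP free0 free_bound.
exists d; last by apply: free_le; split; [exact: Ae | exact: efree].
exists e; split=> // v Av.
have [c Bc] : exists c : 'rV[k]_d, B (v - \sum_i c 0 i *: e i).
  apply: contrapT => nspan.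
  suff : free_dim d.+1 by move/dmax; rewrite ltnn.
  apply/asboolP; exists (fun i => oapp e v (unlift ord0 i)); split=> [i|c].
    by case: unliftP => [j|] _ /=; [exact: Ae | exact: Av].
  rewrite big_ord_recl unlift_none /=.
  under eq_bigr do rewrite liftK /=.
  have [c0 Bc|c0 Bc] := eqVneq (c 0 ord0) 0.
    have /rowP c'0 : \row_i c 0 (lift ord0 i) = 0.
      apply: efree; under eq_bigr do rewrite mxE.
      by rewrite c0 scale0r add0r in Bc.
    apply/rowP => i; rewrite mxE; case: (unliftP ord0 i) => [j|] -> //.
    by move: (c'0 j); rewrite !mxE.
  (* The coefficient of v is nonzero: divide by it. *)
  case: nspan; exists (\row_i (- (c 0 ord0)^-1 * c 0 (lift ord0 i))).
  have := Blin (c 0 ord0)^-1 _ _ Bc B0.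
  rewrite addr0 scalerDr scalerA mulVf // scale1r scaler_sumr -sumrN.
  congr (B (v + _)); apply: eq_bigr => i _.
  by rewrite mxE scalerA mulNr scaleNr opprK.
exists c; split=> // c' Bc'; apply/eqP; rewrite -subr_eq0; apply/eqP.
apply: efree; have := Blin (-1) _ _ Bc Bc'.
congr B; rewrite scaleN1r opprB addrA subrK -sumrB.
by apply: eq_bigr => i _; rewrite !mxE -scalerBl.
Qed.

(** * Derivations and the presentation of k[S] *)

Section Presentation.
Variables (k : fieldType) (S : numsemigroup) (n : mingens S).
Local Notation r := (embdim n).
Local Notation P := {mpoly k[r]}.
Local Notation kS := (sgalg k S).
Local Notation I := (relideal k n).

Lemma sgpolyD (x y : kS) : sgpoly (x + y) = sgpoly x + sgpoly y.
Proof. exact: (rmorphD (val : kS -> {poly k})). Qed.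

Lemma sgpolyM (x y : kS) : sgpoly (x * y) = sgpoly x * sgpoly y.
Proof. exact: (rmorphM (val : kS -> {poly k})). Qed.

Lemma sgpoly1 : sgpoly (1 : kS) = 1.
Proof. exact: (rmorph1 (val : kS -> {poly k})). Qed.

Lemma sgpolyXn (x : kS) e : sgpoly (x ^+ e) = sgpoly x ^+ e.
Proof. exact: (rmorphXn (val : kS -> {poly k})). Qed.

Lemma sgpolyZ a (x : kS) : sgpoly (a *: x) = a *: sgpoly x.
Proof. exact: (linearZZ (val : kS -> {poly k})). Qed.

Lemma sgpoly_sum J (s : seq J) (Q : pred J) (F : J -> kS) :
  sgpoly (\sum_(j <- s | Q j) F j) = \sum_(j <- s | Q j) sgpoly (F j).
Proof. exact: (raddf_sum (val : kS -> {poly k})). Qed.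

Lemma presZ a (p : P) : pres (a *: p) = a *: pres p.
Proof. by rewrite /pres mmapZ mulr_algl. Qed.

Lemma presD (p q : P) : pres (p + q) = pres p + pres q.
Proof. exact: rmorphD. Qed.

Lemma presM (p q : P) : pres (p * q) = pres p * pres q.
Proof. exact: rmorphM. Qed.

Lemma presX (m : 'X_{1..r}) :
  sgpoly (pres 'X_[k, m]) = 'X^(wdeg n m).
Proof.
rewrite /pres mmapX /mmap1 (big_morph (@sgpoly k S) sgpolyM sgpoly1).
rewrite /wdeg -prodrXr; apply: eq_bigr => i _.
by rewrite sgpolyXn /= -exprM mulnC.
Qed.

(** The derivation P -> k[t] with X_i |-> a i.  The target is k[t] and not
    k[S], so that the a i may be arbitrary monomials t^(n_i + l). *)
Definition der_along (a : 'I_r -> {poly k}) (p : P) : {poly k} :=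
  \sum_i a i * sgpoly (pres p^`M(i)).

Lemma der_along_linear a : linear (der_along a).
Proof.
move=> b p q; rewrite /der_along scaler_sumr -big_split /=.
apply: eq_bigr => i _.
by rewrite mderivD mderivZ presD presZ sgpolyD sgpolyZ mulrDr scalerAr.
Qed.

Lemma wdegU i : wdeg n U_(i) = n i.
Proof.
rewrite /wdeg (bigD1 i) //= big1 => [|j]; rewrite mnm1E ?eqxx; first lia.
by rewrite eq_sym => /negPf->.
Qed.

(** On monomials a homogeneous derivation is the linear form c, up to a shift
    by l of the weight. *)
Lemma der_alongX (c : 'I_r -> k) l m :
  der_along (fun i => c i *: 'X^(n i + l)) 'X_[m]
    = (\sum_i c i * (m i)%:R) *: 'X^(wdeg n m + l).
Proof.
rewrite /der_along scaler_suml; apply: eq_bigr => i _.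
rewrite mderivX presZ sgpolyZ presX -scalerAl -scalerAr scalerA.
have [->|mi] := posnP (m i); first by rewrite mulr0 !scale0r.
rewrite -exprD; congr (_ *: 'X^_).
have Ui : (U_(i) <= m)%MM.
  by apply/mnm_lepP => j; rewrite mnm1E; case: eqP => // <-.
rewrite -{2}(submK Ui) wdegD wdegU; lia.
Qed.

(** The restriction to I of the derivation P -> k[S] with X_i |-> a i. *)
Definition der_restr (a : 'I_r -> kS) (x : I) : kS :=
  \sum_i a i * pres (relpoly x : P)^`M(i).

Lemma der_restr_derP a : derP_image (der_restr a).
Proof.
exists (fun p : P => \sum_i a i * pres p^`M(i)) => //; split.
  move=> b p q; rewrite scaler_sumr -big_split /=; apply: eq_bigr => i _.
  by rewrite mderivD mderivZ presD presZ mulrDr scalerAr.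
move=> p q; rewrite !mulr_sumr -big_split /=; apply: eq_bigr => i _.
rewrite mderivM presD !presM.
have leibniz (T : comNzRingType) (x y z y' z' : T) :
    x * (y' * z + y * z') = y * (x * z') + z * (x * y').
  by rewrite mulrDr addrC (mulrCA x y) (mulrC y' z) (mulrCA x z).
exact: leibniz.
Qed.

Lemma sgpoly_der_restr a x :
  sgpoly (der_restr a x) = der_along (fun i => sgpoly (a i)) (relpoly x).
Proof. by rewrite sgpoly_sum; apply: eq_bigr => i _; rewrite sgpolyM. Qed.

Lemma relpolyP (x : I) : pres (relpoly x : P) = 0.
Proof. by move: (valP x); rewrite unfold_in => /eqP. Qed.

(** Total in [p], with junk value 0 outside I, so that maps on I can be
    evaluated at polynomials without carrying membership proofs. *)
Definition mkrel (p : P) : I := insubd (0 : I) (p : P^o).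

Lemma relK (p : P) : pres p = 0 -> relpoly (mkrel p) = p.
Proof. by move=> p0; rewrite insubdK // unfold_in; apply/eqP. Qed.

Lemma presB (p q : P) : pres (p - q) = pres p - pres q.
Proof. exact: rmorphB. Qed.

Lemma presX_eq (a b : 'X_{1..r}) :
  wdeg n a = wdeg n b -> pres ('X_[k, a] - 'X_[b]) = 0.
Proof.
move=> ab; rewrite presB; apply/eqP; rewrite subr_eq0; apply/eqP.
by apply: val_inj; rewrite /= !presX ab.
Qed.

Definition binom_rel (a b : 'X_{1..r}) : I := mkrel ('X_[a] - 'X_[b]).

Lemma binom_relE a b :
  wdeg n a = wdeg n b -> relpoly (binom_rel a b) = 'X_[a] - 'X_[b] :> P.
Proof. by move/presX_eq; exact: relK. Qed.

Lemma relpoly_inj (x y : I) : relpoly x = relpoly y :> P -> x = y.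
Proof. exact: val_inj. Qed.

Lemma relpolyD (x y : I) : relpoly (x + y) = (relpoly x : P) + relpoly y.
Proof. exact: (raddfD (val : I -> P^o)). Qed.

Lemma relpolyZ (p : P) (x : I) : relpoly (p *: x) = p * (relpoly x : P).
Proof. by rewrite [LHS]SubK. Qed.

Lemma relpoly_lin (p : P) (x y : I) :
  relpoly (p *: x + y) = p * (relpoly x : P) + relpoly y.
Proof. by rewrite relpolyD relpolyZ. Qed.

Lemma relpoly0 : relpoly (0 : I) = 0 :> P.
Proof. exact: (raddf0 (val : I -> P^o)). Qed.

(** I is spanned over k by the binomials of equal weight.  Choose a monomial
    X^(rho d) in each weight d that occurs, and replace every monomial of p by
    the chosen one of its weight: the result depends only on the image of p in
    k[S], so it is 0 for p in I.  Hence p is the sum of its coefficients times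
    the binomials X^m - X^(rho (wdeg m)). *)
Lemma relideal_ind (K : I -> Prop) :
    K 0 ->
    (forall c x y, K x -> K y -> K (c%:MP *: x + y)) ->
    (forall a b, wdeg n a = wdeg n b -> K (binom_rel a b)) ->
  forall x, K x.
Proof.
move=> K0 Klin Kbinom x; set p : P := relpoly x.
have [rho rhoE] : exists rho : nat -> 'X_{1..r},
    forall m, wdeg n (rho (wdeg n m)) = wdeg n m.
  have /choice[rho rhoE] d : exists m', forall m, wdeg n m = d -> wdeg n m' = d.
    have [[m mE]|nm] := pselect (exists m, wdeg n m = d); first by exists m.
    by exists 0%MM => m mE; case: nm; exists m.
  by exists rho => m; exact: rhoE.
have pE : sgpoly (pres p) = \sum_(m <- msupp p) p@_m *: 'X^(wdeg n m).
  rewrite {1}[p]mpolyE (big_morph (@pres k S n) presD (rmorph0 _)) sgpoly_sum.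
  by apply: eq_bigr => m _; rewrite presZ sgpolyZ presX.
(* N exceeds all weights in p, so coefficients below N carry all of pres p. *)
pose N := (\sum_(m <- msupp p) wdeg n m).+1.
have sum0 : \sum_(m <- msupp p) p@_m *: 'X_[rho (wdeg n m)] = 0 :> P.
  transitivity (\sum_(i < N) (sgpoly (pres p))`_i *: 'X_[rho i] : P).
    under [RHS]eq_bigr do rewrite pE coef_sum scaler_suml.
    rewrite exchange_big /=; apply: eq_big_seq => m mp.
    have mN : (wdeg n m < N)%N.
      by rewrite ltnS (big_rem m) //= leq_addr.
    rewrite (bigD1 (Ordinal mN)) //= coefZ coefXn eqxx mulr1 big1 ?addr0 //.
    move=> i im; rewrite coefZ coefXn; case: eqP => [e|_].
      by case/eqP: im; exact: val_inj.
    by rewrite mulr0 scale0r.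
  by rewrite relpolyP big1 // => i _; rewrite coef0 scale0r.
have -> : x = \sum_(m <- msupp p) (p@_m)%:MP *: binom_rel m (rho (wdeg n m)).
  apply: relpoly_inj.
  rewrite (big_morph (@relpoly k S n) relpolyD relpoly0).
  under eq_bigr do rewrite relpolyZ binom_relE ?rhoE // mul_mpolyC scalerBr.
  by rewrite big_split /= sumrN sum0 subr0; exact: mpolyE.
elim/big_rec: _ => // m y _ Ky; apply: Klin => //.
by apply: Kbinom; rewrite rhoE.
Qed.

(** * Homomorphisms as derivations *)

Lemma sgpoly0 : sgpoly (0 : kS) = 0.
Proof. exact: (raddf0 (val : kS -> {poly k})). Qed.

Lemma pres_const (c : k) : sgpoly (pres (c%:MP : P)) = c%:P.
Proof.
rewrite -[c%:MP]mulr1 mul_mpolyC presZ sgpolyZ /pres rmorph1 sgpoly1.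
exact: alg_polyC.
Qed.

Lemma der_along_rel_const a c (x y : I) :
  der_along a (relpoly (c%:MP *: x + y))
    = c%:P * der_along a (relpoly x) + der_along a (relpoly y).
Proof.
by rewrite relpoly_lin mul_mpolyC der_along_linear mul_polyC.
Qed.

Lemma der_alongB a (p q : P) :
  der_along a (p - q) = der_along a p - der_along a q.
Proof. by rewrite addrC -scaleN1r der_along_linear scaleN1r addrC. Qed.

(** Here g stands for p |-> f p, with p in I and f in Hom(I, k[S]) of
    degree l, seen with values in k[t]. *)
Section Binomials.
Variables (g : P -> {poly k}) (l : nat).
Hypothesis gD :
  forall p q : P, pres p = 0 -> pres q = 0 -> g (p + q) = g p + g q.
Hypothesis gM :
  forall m p : P, pres p = 0 -> g (m * p) = sgpoly (pres m) * g p.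
Hypothesis g_binom : forall a b, wdeg n a = wdeg n b ->
  forall i, i != (wdeg n a + l)%N -> (g ('X_[a] - 'X_[b]))`_i = 0.

(** The coefficient in g (X^a - X^b) = psi a b * t^(wdeg a + l). *)
Let psi a b : k := (g ('X_[a] - 'X_[b]))`_(wdeg n a + l).

(** From X^(a+a') - X^(b+b') = X^a' (X^a - X^b) + X^b (X^a' - X^b'). *)
Let psiD a b a' b' : wdeg n a = wdeg n b -> wdeg n a' = wdeg n b' ->
  psi (a + a')%MM (b + b')%MM = psi a b + psi a' b'.
Proof.
move=> ab ab'; rewrite /psi.
have pab := presX_eq ab; have pab' := presX_eq ab'.
have -> : 'X_[a + a'] - 'X_[b + b'] = 'X_[a'] * ('X_[a] - 'X_[b])
    + 'X_[b] * ('X_[a'] - 'X_[b']) :> P.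
  rewrite !mpolyXD !mulrBr (mulrC 'X_[a'] 'X_[a]) (mulrC 'X_[a'] 'X_[b]).
  by rewrite addrA subrK.
have pm (m p : P) : pres p = 0 -> pres (m * p) = 0.
  by move=> p0; rewrite presM p0 mulr0.
rewrite (gD (pm _ _ pab) (pm _ _ pab')) (gM _ pab) (gM _ pab').
rewrite !presX coefD !coefXnM wdegD -ab.
rewrite !ifF; [|lia..].
by congr (_`_ _ + _`_ _); lia.
Qed.

Let psi_trans a b c : wdeg n a = wdeg n b -> wdeg n b = wdeg n c ->
  psi a b + psi b c = psi a c.
Proof.
move=> ab bc; rewrite /psi -ab -coefD -gD ?presX_eq //.
by rewrite addrA subrK.
Qed.

Let psi_refl a : psi a a = 0.
Proof.
have /eqP := psi_trans (erefl (wdeg n a)) (erefl (wdeg n a)).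
by rewrite -subr_eq0 addrK => /eqP.
Qed.

Let wdeg_muln a m : wdeg n (a *+ m)%MM = (wdeg n a * m)%N.
Proof.
rewrite /wdeg big_distrl; apply: eq_bigr => i _.
by rewrite mulmnE mulnAC.
Qed.

Let psi_muln a b m : wdeg n a = wdeg n b ->
  psi (a *+ m)%MM (b *+ m)%MM = m%:R * psi a b.
Proof.
move=> ab; elim: m => [|m IH]; first by rewrite !mulm0n psi_refl mul0r.
have abm : wdeg n (a *+ m)%MM = wdeg n (b *+ m)%MM by rewrite !wdeg_muln ab.
rewrite !mulmS (psiD ab abm) IH.
by rewrite -natr1 mulrDl mul1r addrC.
Qed.

(** Put F a := psi (n_j a) (wdeg a * U_j), comparing X^(n_j a) with the power
    of X_j of the same weight.  F is additive in a, hence a linear form, and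
    for a, b of equal weight the cocycle rule gives n_j psi a b = F a - F b.
    So c_i := F U_i / n_j works, and c_j = psi x x / n_j = 0. *)
Lemma binom_derivation (j : 'I_r) : (n j)%:R != 0 :> k ->
  exists2 c : 'I_r -> k, c j = 0 &
    forall a b, wdeg n a = wdeg n b -> g ('X_[a] - 'X_[b])
      = der_along (fun i => c i *: 'X^(n i + l)) ('X_[a] - 'X_[b]).
Proof.
move=> nj0.
pose F a := psi (a *+ n j)%MM (U_(j) *+ wdeg n a)%MM.
have FU a : wdeg n (a *+ n j)%MM = wdeg n (U_(j) *+ wdeg n a)%MM.
  by rewrite !wdeg_muln wdegU mulnC.
have FD a b : F (a + b)%MM = F a + F b.
  rewrite /F wdegD -(psiD (FU a) (FU b)).
  by congr (psi _ _); apply/mnmP => i; rewrite !(mnmDE, mulmnE); lia.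
have F0 : F 0%MM = 0.
  by apply/eqP; rewrite -(inj_eq (addrI (F 0%MM))) -FD addm0 addr0.
have FE a : F a = \sum_i (a i)%:R * F U_(i)%MM.
  rewrite {1}[a]multinomUE_id (big_morph F FD F0); apply: eq_bigr => i _.
  elim: (a i) => [|m IH]; first by rewrite mulm0n F0 mul0r.
  by rewrite mulmS FD IH -natr1 mulrDl mul1r addrC.
have psiE a b : wdeg n a = wdeg n b -> (n j)%:R * psi a b = F a - F b.
  move=> ab; rewrite -(psi_muln (n j) ab) /F.
  have abj : wdeg n (a *+ n j)%MM = wdeg n (b *+ n j)%MM by rewrite !wdeg_muln ab.
  by rewrite ab -(psi_trans abj (FU b)) addrK.
exists (fun i => (n j)%:R^-1 * F U_(i)%MM).
  by rewrite /F wdegU psi_refl mulr0.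
move=> a b ab.
have -> : g ('X_[a] - 'X_[b]) = psi a b *: 'X^(wdeg n a + l).
  apply/polyP => i; rewrite coefZ coefXn.
  have [->|ia] := eqVneq i; first by rewrite mulr1.
  by rewrite mulr0 (g_binom ab).
have coefE (m : 'X_{1..r}) :
    \sum_i (n j)%:R^-1 * F U_(i)%MM * (m i)%:R = (n j)%:R^-1 * F m.
  rewrite FE mulr_sumr; apply: eq_bigr => i _.
  by rewrite mulrCA mulrC mulrA mulrAC.
rewrite der_alongB !der_alongX !coefE -ab -scalerBl -mulrBr -psiE //.
by rewrite mulKf.
Qed.

End Binomials.

(** The index j is free.  This is used to make c vanish at an index where c
    would otherwise count as a coordinate of f modulo derivations into k[S]. *)
Lemma hom_is_derivation (f : I -> kS) (l : nat) (j : 'I_r) :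
    homI_deg l%:Z f -> (n j)%:R != 0 :> k ->
  exists2 c : 'I_r -> k, c j = 0 &
    forall x, sgpoly (f x) = der_along (fun i => c i *: 'X^(n i + l)) (relpoly x).
Proof.
move=> [f_homI fdeg] nj0.
have f_lin p x y : f (p *: x + y) = pres p * f x + f y by exact: f_homI.
have f0 : f 0 = 0.
  have := f_lin 1 0 0; rewrite scaler0 addr0 /pres rmorph1 mul1r => /eqP.
  by rewrite -subr_eq0 opprD addNKr oppr_eq0 => /eqP.
pose g (p : P) : {poly k} := sgpoly (f (mkrel p)).
have gD p q : pres p = 0 -> pres q = 0 -> g (p + q) = g p + g q.
  move=> p0 q0; rewrite /g -sgpolyD; congr sgpoly.
  have -> : mkrel (p + q) = 1 *: mkrel p + mkrel q :> I.
    apply: relpoly_inj.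
    rewrite relpoly_lin mul1r (relK p0) (relK q0) relK //.
    by rewrite presD p0 q0 addr0.
  by rewrite f_lin /pres rmorph1 mul1r.
have gM (m p : P) : pres p = 0 -> g (m * p) = sgpoly (pres m) * g p.
  move=> p0; rewrite /g -sgpolyM; congr sgpoly.
  have -> : mkrel (m * p) = m *: mkrel p + 0 :> I.
    apply: relpoly_inj.
    by rewrite relpoly_lin relpoly0 addr0 (relK p0) relK // presM p0 mulr0.
  by rewrite f_lin f0 addr0.
have g_binom a b : wdeg n a = wdeg n b ->
    forall i, i != (wdeg n a + l)%N -> (g ('X_[a] - 'X_[b]))`_i = 0.
  move=> ab i ia.
  have binom_homog :
      (relpoly (binom_rel a b) : P) \is ishomog1 (wdeg n a) (wdeg n).
    by rewrite binom_relE //; apply: rpredB; rewrite dhomogX // ab.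
  apply/eqP; apply: contraT => gi.
  have := fdeg _ _ binom_homog i gi => /eqP.
  by rewrite -PoszD eqz_nat (negPf ia).
have [c cj cE] := binom_derivation gD gM g_binom nj0.
exists c => //; elim/relideal_ind => [|b x y IHx IHy|a b ab].
- rewrite f0 relpoly0 sgpoly0 /der_along big1 // => i _.
  by rewrite mderiv0 /pres rmorph0 sgpoly0 mulr0.
- by rewrite f_lin sgpolyD sgpolyM pres_const der_along_rel_const IHx IHy.
by rewrite -[LHS]/(g _) cE // binom_relE.
Qed.

End Presentation.

(** * Counting *)

Section Combinatorics.
Variables (S : numsemigroup) (n : mingens S).
Local Notation r := (embdim n).

(** A generator 0 could be dropped, against minimality. *)
Lemma gen_gt0 (i : 'I_r) : (0 < n i)%N.
Proof.
rewrite lt0n; apply/eqP => ni0.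
suff : predC1 i i by rewrite /= eqxx.
apply: (@gen_min _ n); rewrite -(gen_span n).
apply/seteqP; split=> _ [c ->]; last first.
  by exists c; rewrite (bigD1 i) //= ni0 muln0.
by rewrite gen_span; exact: (nongap_lc _ _ (@nongap_gen S n)).
Qed.

Lemma gaps_bounded : exists M, forall l, (M <= l)%N -> nongap S l.
Proof.
have /finite_fsetP[X XE] := finite_gaps S.
exists (\sum_(x <- X) x).+1 => m mX; apply: contrapT => Sm.
have {}Sm : m \in X by have : (~` S)%classic m by []; rewrite XE.
by move: mX; rewrite (big_fsetD1 m) //= ltnNge leq_addr.
Qed.

Lemma has_gen : exists i : 'I_r, True.
Proof.
have [M SM] := gaps_bounded.
have : nongap S M.+1 by exact: SM.
rewrite -(gen_span n) => -[c]; case: (posnP r) => [r0|r0 _].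
  by rewrite big1 // => -[i ir] _; exfalso; move: ir; rewrite r0.
by exists (Ordinal r0).
Qed.

(** End(S) can be tested on generators, since every nonzero s in S is some n_i
    plus an element of S. *)
Lemma notin_EndP l : ~ End S l -> exists i : 'I_r, ~ nongap S (n i + l)%N.
Proof.
move=> nEnd; apply: contrapT => Snl; apply: nEnd => s Ss s0.
have [c sE] : nat_span n predT s by rewrite gen_span.
have [i ci] : exists i, (0 < c i)%N.
  apply: contrapT => c0; apply: s0; rewrite sE big1 // => i _.
  by case: (posnP (c i)) => [->//|ci]; case: c0; exists i.
have Sil : nongap S (n i + l)%N by apply: contrapT => Sil; apply: Snl; exists i.
pose c' (m : 'I_r) := if m == i then (c i).-1 else c m.
have Sc' := nongap_lc c' predT (@nongap_gen S n).
have -> : (l + s = n i + l + \sum_(m | predT m) c' m * n m)%N.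
  rewrite sE (bigD1 i) //= [in RHS](bigD1 i) //= /c' eqxx.
  under [in RHS]eq_bigr => m /negPf-> do [].
  by case: (c i) ci => // e _; rewrite mulSn /=; lia.
exact: nongapD.
Qed.

Lemma gen_gap (i : 'I_r) l : ~ nongap S (n i + l)%N -> ~ nongap S l.
Proof. by move=> + Sl; apply; apply: nongapD => //; exact: nongap_gen. Qed.

Lemma sum_fset_set (M : nat) (X : set nat) (f : nat -> nat) :
    (forall l, X l -> (l < M)%N) ->
  (\sum_(l <- fset_set X) f l = \sum_(l < M | `[< X l >]) f l)%N.
Proof.
move=> XM; have finX : finite_set X.
  by apply: (sub_finite_set XM); exact: finite_II.
rewrite -(big_mkord (fun l => `[< X l >])) -[RHS]big_filter.
apply: perm_big; apply: uniq_perm; rewrite ?filter_uniq ?iota_uniq //.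
move=> l; rewrite in_fset_set // mem_filter mem_index_iota /=.
apply/idP/andP => [/set_mem Xl|[/asboolP Xl _]]; last exact: mem_set.
by split; [exact/asboolP | exact: XM].
Qed.

Lemma card_fset_set (M : nat) (X : set nat) :
    (forall l, X l -> (l < M)%N) ->
  #|` fset_set X| = #|[set l : 'I_M | `[< X l >]]|.
Proof.
move=> XM; rewrite card_fset_sum1 (sum_fset_set _ XM) sum1dep_card.
by rewrite cardsE.
Qed.

Variables (M : nat) (j : nat -> 'I_r).
Hypothesis SM : forall l, (M <= l)%N -> nongap S l.
Hypothesis jP : forall l, ~ End S l -> ~ nongap S (n (j l) + l)%N.

(** The pairs (l, i) for which c_i is a coordinate in degree l.  All such l are
    gaps, so the bound M on the gaps makes this a finite set. *)
Definition T1_index : {set 'I_M * 'I_r} :=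
  [set q : 'I_M * 'I_r | ~~ `[< nongap S (n q.2 + q.1)%N >] & q.2 != j q.1].

Lemma gap_ltM l : ~ nongap S l -> (l < M)%N.
Proof. by move=> Sl; rewrite ltnNge; apply/negP => /SM. Qed.

(** Adding the pairs (l, j l), for l outside End(S), to the index set gives
    all pairs with n_i + l a gap.  These embed into the pairs counted by
    ewt(S), as n_i + l > n_i. *)
Lemma card_T1_index : (#|T1_index| + genus S <= ewt n + lambda S)%N.
Proof.
pose D := [set l : 'I_M | ~~ `[< End S l >]].
pose A := [set q : 'I_M * 'I_r | ~~ `[< nongap S (n q.2 + q.1)%N >]].
have genus_le : (genus S <= lambda S + #|D|)%N.
  rewrite /genus /lambda !(@card_fset_set M) => [|l [_]|l]; try exact: gap_ltM.
  apply: leq_trans (leq_card_setU _ _); apply: subset_leq_card.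
  apply/fintype.subsetP => l; rewrite !inE => Sl.
  apply/orP; have [El|El] := pselect (End S l).
    by left; apply/asboolP; split; [exact: El | exact: Sl].
  by right; exact/asboolPn.
have index_le : (#|T1_index| + #|D| <= #|A|)%N.
  pose J := [set (l, j l) | l : 'I_M in D].
  have <- : #|J| = #|D| by apply: card_imset => l l' [].
  have TJ : [disjoint T1_index & J].
    apply/pred0P => q /=; apply/negP => /andP[].
    by rewrite inE => /andP[_ jq] /imsetP[l _ qE]; rewrite qE eqxx in jq.
  rewrite -cardsUI (_ : T1_index :&: J = finset.set0); last exact: disjoint_setI0.
  rewrite cards0 addn0; apply/subset_leq_card/fintype.subsetP => q.
  rewrite !inE => /orP[/andP[]//|/imsetP[l]]; rewrite inE => /asboolPn El ->.
  by apply/asboolPn; exact: jP.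
have A_le : (#|A| <= ewt n)%N.
  pose W := [set q : 'I_M * 'I_r | `[< (~` S)%classic q.1 >] && (n q.2 < q.1)%N].
  have -> : ewt n = #|W|.
    rewrite /ewt (@sum_fset_set M _ (fun l => #|[pred i | n i < l]%N|)).
      under eq_bigr do rewrite -sum1_card.
      by rewrite pair_big_dep sum1dep_card cardsE.
    exact: gap_ltM.
  (* The default value q.1 is never used on A, where n q.2 + q.1 < M. *)
  pose h (q : 'I_M * 'I_r) := (insubd q.1 (n q.2 + q.1)%N, q.2).
  have hE q : q \in A -> (h q).1 = (n q.2 + q.1)%N :> nat.
    rewrite inE => /asboolPn Sq; rewrite val_insubd ifT //; exact: gap_ltM.
  have <- : #|h @: A| = #|A|.
    apply: card_in_imset => q q' Aq Aq' hqq'.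
    have e2 : q.2 = q'.2 by case: hqq'.
    have e1 : (n q.2 + q.1 = n q'.2 + q'.1)%N by rewrite -!hE // hqq'.
    rewrite e2 in e1; move: q q' e1 e2 {hqq' Aq Aq'} => [a b] [a' b'] /= e1 e2.
    by congr (_, _) => //; apply: val_inj => /=; lia.
  apply/subset_leq_card/fintype.subsetP => _ /imsetP[q Aq ->].
  rewrite inE hE //; move: Aq; rewrite inE => Aq.
  apply/andP; split=> /=; first by apply/asboolP => Sq; move/asboolPn: Aq; apply.
  rewrite -[X in (X < _)%N]addn0 ltn_add2l lt0n.
  apply: contraNneq Aq => ->; rewrite addn0.
  by apply/asboolP; exact: nongap_gen.
lia.
Qed.
End Combinatorics.

(** * Bounding the positive part of T^1 *)

Section T1Bound.
Variables (k : fieldType) (S : numsemigroup) (n : mingens S).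
Variables (M : nat) (j : nat -> 'I_(embdim n)).
Hypothesis SM : forall l, (M <= l)%N -> nongap S l.
Hypothesis char0 : forall m, (0 < m)%N -> m%:R != 0 :> k.
Local Notation r := (embdim n).
Local Notation P := {mpoly k[r]}.
Local Notation kS := (sgalg k S).
Local Notation I := (relideal k n).
Local Notation Q := (T1_index M j).

(** The derivation X_i |-> t^(n_i + l), the other variables going to 0, for
    q = (l, i); it takes values in k[t] only. *)
Definition shift_der (q : 'I_M * 'I_r) (x : I) : {poly k} :=
  'X^(n q.2 + q.1) * sgpoly (pres (relpoly x : P)^`M(q.2)).

(** The row c represents v modulo derivations into k[S].  It is a relation and
    not a map because the single terms of the sum need not lie in
    Hom(I, k[S]). *)
Definition has_coords (v : I -> kS) (c : 'rV[k]_#|Q|) : Prop :=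
  exists2 b : I -> kS, derP_image b &
    forall x, sgpoly (v x) =
      sgpoly (b x) + \sum_t c 0 t *: shift_der (enum_val t) x.

Lemma derP_image0 : derP_image (0 : I -> kS).
Proof.
exists (fun=> 0) => //; split=> [a p q|p q]; first by rewrite scaler0 addr0.
by rewrite !mulr0 addr0.
Qed.

Lemma derP_image_linear a (u v : I -> kS) :
  derP_image u -> derP_image v -> derP_image (a *: u + v).
Proof.
move=> [D [Dlin Dleib] ->] [E [Elin Eleib] ->].
exists (fun p => a *: D p + E p) => //; split=> [b p q|p q].
  rewrite Dlin Elin !scalerDr !scalerA mulrC -!addrA; congr (_ + _).
  by rewrite addrCA.
rewrite Dleib Eleib scalerDr !mulrDr !scalerAr -!addrA; congr (_ + _).
by rewrite addrCA.
Qed.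

Lemma has_coords_linear a u v b c : has_coords u b -> has_coords v c ->
  has_coords (a *: u + v) (a *: b + c).
Proof.
move=> [d Bd uE] [e Be vE]; exists (a *: d + e); first exact: derP_image_linear.
move=> x; rewrite [LHS]sgpolyD [X in _ = X + _]sgpolyD !sgpolyZ uE vE.
rewrite scalerDr -!addrA; congr (_ + _); rewrite addrCA; congr (_ + _).
rewrite scaler_sumr -big_split /=; apply: eq_bigr => t _.
by rewrite !mxE scalerA scalerDl.
Qed.

Lemma has_coords0 : has_coords 0 0.
Proof.
exists 0; first exact: derP_image0.
by move=> x; rewrite big1 ?addr0 // => t _; rewrite mxE scale0r.
Qed.

Lemma has_coords_derP v : has_coords v 0 -> derP_image v.
Proof.
move=> [b Bb vE]; suff -> : v = b by [].
apply/funext => x; apply: val_inj; rewrite /= vE big1 ?addr0 // => t _.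
by rewrite mxE scale0r.
Qed.

(** The terms c_i t^(n_i + l) with n_i + l in S form a derivation into k[S];
    of the other terms, the one at j l is zero and the rest is indexed by Q. *)
Lemma homI_deg_coords (f : I -> kS) (l : nat) :
  homI_deg l%:Z f -> exists c, has_coords f c.
Proof.
move=> f_hom; have nj0 := char0 (gen_gt0 (j l)).
have [c cj fE] := hom_is_derivation f_hom nj0.
pose a i : kS := if pselect (nongap S (n i + l)%N) is left Sil
  then c i *: sgmon k Sil else 0.
pose coord (q : 'I_M * 'I_r) : k := if q.1 == l :> nat then c q.2 else 0.
exists (\row_t coord (enum_val t)); exists (der_restr a).
  exact: der_restr_derP.
move=> x; rewrite fE sgpoly_der_restr.
under [X in _ = _ + X]eq_bigr do rewrite mxE.
rewrite -(big_enum_val (A := mem Q) (fun q => coord q *: shift_der q x)).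
rewrite big_mkcond /=.
rewrite [X in _ + X](_ : _ = \sum_(m < M) \sum_i
  if (m, i) \in Q then coord (m, i) *: shift_der (m, i) x else 0); last first.
  by rewrite pair_bigA; apply: eq_bigr => -[].
rewrite exchange_big /= /der_along -big_split /=; apply: eq_bigr => i _.
rewrite /shift_der /=; set p := sgpoly (pres _).
rewrite /a; case: pselect => [Sil|Sil].
  rewrite sgpolyZ /= big1 ?addr0 // => m _; case: ifP => //.
  rewrite inE /= /coord /= => /andP[/asboolPn Sim _].
  by case: eqP => [ml|_]; rewrite ?scale0r //; case: Sim; rewrite ml.
rewrite sgpoly0 mul0r add0r (bigD1 (Ordinal (gap_ltM SM (gen_gap Sil)))) //=.
rewrite big1 ?addr0 => [|m ml]; last first.
  case: ifP => // _; rewrite /coord /=; case: eqP => [e|_]; last by rewrite scale0r.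
  by case/eqP: ml; apply: val_inj.
rewrite inE /coord /= eqxx scalerAl; case: ifPn => // /nandP[].
  by rewrite negbK => /asboolP.
by rewrite negbK => /eqP ->; rewrite cj scale0r mul0r.
Qed.

Lemma T1_pos_dim_le :
  exists2 d, T1_pos_dim k n d & (d <= #|Q|)%N.
Proof.
apply: (dim_mod_le derP_image0 derP_image_linear has_coords0 has_coords_linear
  _ has_coords_derP).
move=> _ [N [h [hdeg ->]]].
elim/big_rec: _ => [|i v _ [c vc]]; first by exists 0; exact: has_coords0.
have [b hb] := homI_deg_coords (hdeg i).
by exists (1 *: b + c); rewrite -[h i]scale1r; exact: has_coords_linear.
Qed.

End T1Bound.

Theorem proposition2p8 (k : closedFieldType) (chark : [pchar k] =i pred0)
    (S : numsemigroup) (n : mingens S) (g_gt0 : (1 <= genus S)%N) :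
  exists2 d : nat, T1_pos_dim k n d &
    3 * (genus S)%:Z - 2 - (ewt n)%:Z
      <= 2 * (genus S)%:Z - 2 + (lambda S)%:Z - d%:Z.
Proof.
have char0 m : (0 < m)%N -> m%:R != 0 :> k.
  move=> m0; apply/negP => /(natf0_pchar m0)[p].
  by rewrite chark.
have [M SM] := gaps_bounded S.
have [i0 _] := has_gen n.
have /choice[j jP] l : exists i, ~ End S l -> ~ nongap S (n i + l)%N.
  (* On End(S) any index will do, since no c_i survives in such a degree. *)
  have [El|/(notin_EndP n)[i Sil]] := pselect (End S l); first by exists i0.
  by exists i.
have [d dT1 dQ] := T1_pos_dim_le j SM char0.
exists d => //; have := card_T1_index SM jP; lia.
Qed.
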